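(* Let $f_1,\dots,f_n:\mathbb{R}^d\to\mathbb{R}$ be convex, twice differentiable and $L$-smooth, with Hessians $H_i$ satisfying $\|H_i(x)-H_i(y)\|\le L_H\|x-y\|$ for all $x,y$, and suppose $F=\frac1n\sum_{i=1}^n f_i$ is $\mu$-strongly convex with $\mu>0$ and unique minimizer $x^*$. Assume the boundedness assumptions with constants $D,G$ stated in the context. Define $$C=\max\Big\{\frac{32}{\mu^2}\big(L_HLD+3L_HG\big),\;12\Big(1+\frac{L}{\mu}\Big)\Big\}.$$ Let $T\ge2$ be a multiple of $n$ with $\frac{T}{\log T}>Cn$, and run RandomShuffle on $F$ for $T$ iterations with constant step size $\frac{8\log T}{T\mu}$. Then $$\mathbb{E}\big[\|x_T-x^*\|^2\big]\le \mathcal{O}\Big(\frac{1}{T^2}+\frac{n^3}{T^3}\Big).$$ That is, there are constants $C_0,q>0$ depending only on $\mu,L,L_H,D,G$ such that the left side is at most $C_0(1+\log T)^q\big(\frac1{T^2}+\frac{n^3}{T^3}\big)$.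
   Context: Norms are Euclidean for vectors and spectral for matrices. $f$ is $L$-smooth if $\|\nabla f(x)-\nabla f(y)\|\le L\|x-y\|$ for all $x,y$. $F$ is $\mu$-strongly convex if $F(x)\ge F(y)+\langle\nabla F(y),x-y\rangle+\frac{\mu}{2}\|x-y\|^2$ for all $x,y$. RandomShuffle with step size $\gamma$, run for $T=ln$ iterations ($l$ a positive integer, the number of epochs) from $x_0\in\mathbb{R}^d$: set $x^1_0=x_0$. In each epoch $t=1,\dots,l$ draw a permutation $\sigma_t$ of $\{1,\dots,n\}$ uniformly at random, independently across epochs, and for $k=1,\dots,n$ set $x^t_k=x^t_{k-1}-\gamma\nabla f_{\sigma_t(k)}(x^t_{k-1})$; then put $x^{t+1}_0=x^t_n$. The output is $x_T=x^l_n$. Expectation is over the permutations. Boundedness assumptions: there are constants $D,G>0$ such that, for every realization of the permutations, every iterate $x$ satisfies $\|x-x^*\|\le D$; and $\|\nabla f_i(x)\|\le G$ for all $i$ and all $x$ with $\|x-x^*\|\le D$. Convention: $\mathcal{O}(\cdot)$ hides logarithmic factors and constants depending only on the problem constants, not on $n$ or $T$. *)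

(* Defs.v *)
From HB Require Import structures.
From mathcomp Require Import all_boot all_order all_algebra all_fingroup.
From mathcomp Require Import all_classical all_reals all_analysis.

Set Implicit Arguments.
Unset Strict Implicit.
Unset Printing Implicit Defensive.

Import Order.TTheory GRing.Theory Num.Theory.
Import numFieldNormedType.Exports.

Local Open Scope classical_set_scope.
Local Open Scope ring_scope.

Section Euclidean.
Context {R : realType} {d : nat}.
Implicit Types (u v x y : 'rV[R]_d) (A : 'M[R]_d) (f F : 'rV[R]_d -> R).

Definition dot u v : R := \sum_(j < d) u 0 j * v 0 j.

(* The library's norm [`|u|] on matrices is the sup norm; the Euclidean one
   induces the same topology, hence the same notion of differentiability. *)
Definition enorm u : R := Num.sqrt (dot u u).

(* Vectors are rows, so [v *m A^T] is the vector A v. *)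
Definition spectral_norm A : R :=
  sup [set enorm (v *m A^T) | v in [set v | enorm v <= 1]].

Definition grad f x : 'rV[R]_d := \row_(j < d) 'D_(delta_mx 0 j) f x.

(* Entry (i, j) is the derivative in direction i of the j-th partial derivative
   of f. *)
Definition hessian f x : 'M[R]_d := 'J (grad f) x.

Definition twice_differentiable f : Prop :=
  (forall x, differentiable f x) /\ (forall x, differentiable (grad f) x).

Definition smooth (L : R) f : Prop :=
  forall x y, enorm (grad f x - grad f y) <= L * enorm (x - y).

Definition hessian_lipschitz (LH : R) f : Prop :=
  forall x y,
    spectral_norm (hessian f x - hessian f y) <= LH * enorm (x - y).

Definition strongly_convex (mu : R) F : Prop :=
  forall x y,
    F y + dot (grad F y) (x - y) + mu / 2 * enorm (x - y) ^+ 2 <= F x.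

Definition unique_minimizer F x : Prop :=
  (forall y, F x <= F y) /\ (forall z, (forall y, F z <= F y) -> z = x).

Definition average n (f : 'I_n -> 'rV[R]_d -> R) : 'rV[R]_d -> R :=
  fun x => n%:R^-1 * \sum_(i < n) f i x.

End Euclidean.

Section RandomShuffle.
Context {R : realType} {d n l : nat}.
Variables (gamma : R) (f : 'I_n -> 'rV[R]_d -> R).

Definition sgd_step (x : 'rV[R]_d) (i : 'I_n) : 'rV[R]_d :=
  x - gamma *: grad (f i) x.

(* The point reached from x after the first k steps of an epoch whose
   permutation is s; component functions, like epochs below, are numbered
   from 0. *)
Definition epoch_iterate (s : 'S_n) (x : 'rV[R]_d) (k : nat) : 'rV[R]_d :=
  foldl sgd_step x (take k [seq s j | j <- enum 'I_n]).

(* The point reached from x0 after t full epochs. *)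
Definition epoch_start (x0 : 'rV[R]_d) (sigma : {ffun 'I_l -> 'S_n}) (t : nat) :
    'rV[R]_d :=
  foldl (fun x s => epoch_iterate s x n) x0
    (take t [seq sigma u | u <- enum 'I_l]).

Definition iterate (x0 : 'rV[R]_d) (sigma : {ffun 'I_l -> 'S_n})
    (t : 'I_l) (k : nat) : 'rV[R]_d :=
  epoch_iterate (sigma t) (epoch_start x0 sigma t) k.

Definition output (x0 : 'rV[R]_d) (sigma : {ffun 'I_l -> 'S_n}) : 'rV[R]_d :=
  epoch_start x0 sigma l.

End RandomShuffle.

(* Independent uniform permutations sigma_1, ..., sigma_l are the same as a
   uniform element of the finite product of l copies of the symmetric group. *)
Definition shuffle_expectation {R : realType} (n l : nat)
    (X : {ffun 'I_l -> 'S_n} -> R) : R :=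
  (\sum_(sigma : {ffun 'I_l -> 'S_n}) X sigma)
    / #|{: {ffun 'I_l -> 'S_n}}|%:R.

Definition epoch_constant {R : realType} (mu L LH D G : R) : R :=
  Num.max (32 / mu ^+ 2 * (LH * L * D + 3 * LH * G)) (12 * (1 + L / mu)).

(* Main.v *)
Require Import Defs.
From HB Require Import structures.
From mathcomp Require Import all_boot all_order all_algebra all_fingroup.
From mathcomp Require Import all_classical all_reals all_analysis.
From mathcomp Require Import ring lra.

(** Write e = x - x* for the error at the start x of an epoch, p for the full
    gradient at x, H for the average Hessian at x, and h = gamma * n for the
    total step of the epoch. An epoch is a gradient step x - h p plus a
    deviation of size O(h^2), because the components are evaluated at points
    that have moved by O(h). The square of the deviation costs only O(h^4), but
    its inner product with e is too large to be estimated by its size.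

    Expanding each component gradient at x shows that, up to O(h^3), the
    deviation is gamma^2 times the sum of g_i H_j over the pairs (i, j) in which
    component i is visited before component j, with g_i and H_j the component
    gradient and Hessian at x (vectors are rows). Visit the components in the
    reverse order: the two sums together run over all pairs of distinct
    components, so their total is independent of the permutation and equals
    h^2 p H minus gamma^2 times the sum of the n diagonal terms g_i H_i
    ([sum_pairs_reversed], [second_order_part_reversed]). The diagonal terms
    contribute O(gamma^2 n) only, and this is where random reshuffling gains.

    The part h^2 p H is not small compared with h mu |e|, but it is harmless:
    H is symmetric, so <e, p H> = <e H, p>, and e H is p up to LH |e|^2; hence
    it acts like a multiple of |p|^2, which cocoercivity absorbs into
    <e, p>, while the cubic cross term has a favourable sign because H is
    positive semidefinite. What comes out ([pair_contraction]) is that the mean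
    squared error of the two opposite epochs is at most
    (1 - h mu / 4) |e|^2 + O(gamma^3 n + h^4).

    Since reversing the permutation of one epoch is an involution of the finite
    probability space that leaves all earlier epochs unchanged, this pairwise
    bound gives a recursion for the mean squared error
    ([total_error_step]), with no computation of moments of a random
    permutation. Over l epochs the initial error is multiplied by at most
    exp(- h mu l / 4), which is T^-2 for the chosen step size, and the additive
    errors sum to O(gamma^2 + h^3); here gamma^2 and h^3 are 1 / T^2 and
    n^3 / T^3 up to factors log T. *)

Set Implicit Arguments.
Unset Strict Implicit.
Unset Printing Implicit Defensive.

Import Order.TTheory GRing.Theory Num.Theory.
Import numFieldNormedType.Exports.

Local Open Scope classical_set_scope.
Local Open Scope ring_scope.

(** * Euclidean geometry of row vectors *)

Section EuclideanGeometry.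
Context {R : realType} {d : nat}.
Implicit Types (u v w x y : 'rV[R]_d) (A : 'M[R]_d).

Lemma dotC u v : dot u v = dot v u.
Proof. by apply: eq_bigr => j _; rewrite mulrC. Qed.

Lemma dotDl u v w : dot (u + v) w = dot u w + dot v w.
Proof.
by rewrite -big_split; apply: eq_bigr => j _; rewrite mxE mulrDl.
Qed.

Lemma dotZl (a : R) u w : dot (a *: u) w = a * dot u w.
Proof. by rewrite mulr_sumr; apply: eq_bigr => j _; rewrite mxE mulrA. Qed.

Lemma dotNl u w : dot (- u) w = - dot u w.
Proof. by rewrite -scaleN1r dotZl mulN1r. Qed.

Lemma dotDr u v w : dot w (u + v) = dot w u + dot w v.
Proof. by rewrite !(dotC w) dotDl. Qed.

Lemma dotZr (a : R) u w : dot w (a *: u) = a * dot w u.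
Proof. by rewrite !(dotC w) dotZl. Qed.

Lemma dotNr u w : dot w (- u) = - dot w u.
Proof. by rewrite !(dotC w) dotNl. Qed.

Definition dotE := (dotDl, dotDr, dotZl, dotZr, dotNl, dotNr).

Lemma dot0l u : dot 0 u = 0.
Proof. by rewrite -(scale0r u) dotZl mul0r. Qed.

Lemma dot_ge0 u : 0 <= dot u u.
Proof. by apply: sumr_ge0 => j _; rewrite -expr2 sqr_ge0. Qed.

Lemma dot_mulmx_tr u v A : dot (u *m A) v = dot u (v *m A^T).
Proof.
rewrite /dot; under eq_bigr do rewrite mxE mulr_suml.
rewrite exchange_big; apply: eq_bigr => j _.
by rewrite mxE mulr_sumr; apply: eq_bigr => i _; rewrite mxE; ring.
Qed.

Lemma enorm_ge0 u : 0 <= enorm u.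
Proof. exact: sqrtr_ge0. Qed.

Lemma sqr_enorm u : enorm u ^+ 2 = dot u u.
Proof. by rewrite sqr_sqrtr ?dot_ge0. Qed.

Lemma enorm0 : enorm (0 : 'rV[R]_d) = 0.
Proof. by rewrite /enorm dot0l sqrtr0. Qed.

Lemma enormZ (a : R) u : enorm (a *: u) = `|a| * enorm u.
Proof.
by rewrite /enorm dotZl dotZr mulrA -expr2 sqrtrM ?sqr_ge0// sqrtr_sqr.
Qed.

Lemma enormN u : enorm (- u) = enorm u.
Proof. by rewrite -scaleN1r enormZ normrN1 mul1r. Qed.

Lemma enorm_distC u v : enorm (u - v) = enorm (v - u).
Proof. by rewrite -enormN opprB. Qed.

Lemma enorm0_eq0 u : enorm u = 0 -> u = 0.
Proof.
move=> u0; have /eqP : dot u u = 0 by rewrite -sqr_enorm u0 expr0n.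
rewrite psumr_eq0 => [/allP h|j _]; last by rewrite -expr2 sqr_ge0.
apply/rowP => j; have := h j (mem_index_enum j).
by rewrite mxE -expr2 sqrf_eq0 => /eqP.
Qed.

Lemma sqr_enormD u v :
  enorm (u + v) ^+ 2 = enorm u ^+ 2 + 2 * dot u v + enorm v ^+ 2.
Proof. by rewrite !sqr_enorm !dotE (dotC v u); ring. Qed.

(** Expand the squared norm of [enorm v *: u - enorm u *: v]. *)
Lemma cauchy_schwarz u v : dot u v <= enorm u * enorm v.
Proof.
have := enorm_ge0 u; rewrite le_eqVlt => /predU1P[u0|u_gt0].
  by rewrite -u0 (enorm0_eq0 (esym u0)) dot0l mul0r.
have := enorm_ge0 v; rewrite le_eqVlt => /predU1P[v0|v_gt0].
  by rewrite -v0 (enorm0_eq0 (esym v0)) dotC dot0l mulr0.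
have := dot_ge0 (enorm v *: u - enorm u *: v).
rewrite !dotE (dotC v u) -!sqr_enorm => h.
rewrite -subr_ge0 -(pmulr_rge0 _ (mulr_gt0 u_gt0 v_gt0)).
lra.
Qed.

Lemma norm_dot_le u v : `|dot u v| <= enorm u * enorm v.
Proof.
by rewrite ler_norml cauchy_schwarz andbT lerNl -dotNl -(enormN u) cauchy_schwarz.
Qed.

Lemma ler_enormD u v : enorm (u + v) <= enorm u + enorm v.
Proof.
rewrite -ler_sqr ?nnegrE ?addr_ge0 ?enorm_ge0// sqr_enormD.
by have := cauchy_schwarz u v; lra.
Qed.

Lemma ler_enormB u v : enorm (u - v) <= enorm u + enorm v.
Proof. by rewrite (le_trans (ler_enormD _ _))// enormN. Qed.

Lemma ler_enorm_sum (I : Type) (r : seq I) (P : pred I) (F : I -> 'rV[R]_d) :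
  enorm (\sum_(i <- r | P i) F i) <= \sum_(i <- r | P i) enorm (F i).
Proof.
elim/big_rec2: _ => [|i a u _ h]; first by rewrite enorm0.
by rewrite (le_trans (ler_enormD _ _))// lerD2l.
Qed.

Lemma enorm_le_of_dot u (c : R) : 0 <= c ->
  (forall v, dot u v <= c * enorm v) -> enorm u <= c.
Proof.
move=> c0 /(_ u); rewrite -sqr_enorm expr2.
have := enorm_ge0 u; rewrite le_eqVlt => /predU1P[<-//|u0].
by rewrite ler_pM2r.
Qed.

Lemma enorm_mulmx_le_rows u A :
  enorm (u *m A) <= enorm u * \sum_i enorm (row i A).
Proof.
have -> : u *m A = \sum_i u 0 i *: row i A by rewrite mulmx_sum_row.
rewrite (le_trans (ler_enorm_sum _ _ _))// mulr_sumr ler_sum// => i _.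
rewrite enormZ ler_wpM2r ?enorm_ge0//.
rewrite -ler_sqr ?nnegrE ?enorm_ge0// sqr_enorm real_normK ?num_real//.
rewrite /dot (bigD1 i)//= -expr2 lerDl sumr_ge0// => j _.
by rewrite -expr2 sqr_ge0.
Qed.

Lemma spectral_norm_has_sup A :
  has_sup [set enorm (v *m A^T) | v in [set v | enorm v <= 1]].
Proof.
split; first by exists (enorm (0 *m A^T)), 0 => //=; rewrite enorm0 ler01.
exists (\sum_i enorm (row i A^T)) => _ [v /= v1 <-].
rewrite (le_trans (enorm_mulmx_le_rows _ _))// ler_piMl// sumr_ge0// => i _.
exact: enorm_ge0.
Qed.

Lemma enorm_mulmx_tr_le u A : enorm (u *m A^T) <= spectral_norm A * enorm u.
Proof.
have := enorm_ge0 u; rewrite le_eqVlt => /predU1P[u0|u_gt0].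
  by rewrite -u0 (enorm0_eq0 (esym u0)) mul0mx enorm0 mulr0.
have : enorm (((enorm u)^-1 *: u) *m A^T) <= spectral_norm A.
  apply: ub_le_sup; first by have [] := spectral_norm_has_sup A.
  exists ((enorm u)^-1 *: u) => //=.
  by rewrite enormZ gtr0_norm ?invr_gt0// mulVf ?gt_eqF.
rewrite -scalemxAl enormZ gtr0_norm ?invr_gt0//.
by rewrite mulrC ler_pdivrMr.
Qed.

Lemma spectral_norm_ge0 A : 0 <= spectral_norm A.
Proof.
apply: ub_le_sup; first by have [] := spectral_norm_has_sup A.
by exists 0; rewrite /= ?mul0mx ?enorm0 ?ler01.
Qed.

(** A matrix and its transpose have the same spectral norm. This is needed
    because [spectral_norm] is defined by the action on columns, whereas the
    derivative of a gradient in direction [u] is the row product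
    [u *m hessian f x]. *)
Lemma enorm_mulmx_le u A : enorm (u *m A) <= spectral_norm A * enorm u.
Proof.
have [d0|/eqP unz] := eqVneq (enorm (u *m A)) 0.
  by rewrite d0 mulr_ge0 ?enorm_ge0 ?spectral_norm_ge0.
have un0 : 0 < enorm (u *m A) by rewrite lt_neqAle enorm_ge0 eq_sym andbT; apply/eqP.
rewrite -(ler_pM2r un0) -expr2 sqr_enorm dot_mulmx_tr.
rewrite (le_trans (cauchy_schwarz _ _))// mulrAC mulrC ler_wpM2r ?enorm_ge0//.
exact: enorm_mulmx_tr_le.
Qed.

End EuclideanGeometry.

(** * Derivatives along lines and Taylor estimates *)

Section LineDerivatives.
Context {R : realType} {d : nat}.
Implicit Types (u v w x y : 'rV[R]_d) (f : 'rV[R]_d -> R).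

Lemma is_derive_line (g : 'rV[R]_d -> R) x w (s dg : R) :
  is_derive (x + s *: w) w g dg -> is_derive s 1 (fun r : R => g (x + r *: w)) dg.
Proof.
move=> [dex <-].
have E : (fun h => h^-1 *: (((fun r : R => g (x + r *: w)) \o shift s) (h *: 1)
            - g (x + s *: w)))
    = (fun h => h^-1 *: ((g \o shift (x + s *: w)) (h *: w) - g (x + s *: w))).
  apply/funext => h /=; congr (_ *: (g _ - _)).
  by rewrite [h *: 1]mulr1 scalerDl addrCA addrA.
apply: DeriveDef; first by rewrite /derivable E.
by rewrite /derive E.
Qed.

Lemma is_derive_grad f x w :
  differentiable f x -> is_derive x w f (dot (grad f x) w).
Proof.
move=> df; apply: DeriveDef; first exact: diff_derivable.
rewrite deriveE// {1}[w]row_sum_delta linear_sum; apply: eq_bigr => j _.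
by rewrite linearZ/= mxE deriveE// mulrC.
Qed.

Lemma is_derive_hessian f x w u :
  differentiable (grad f) x ->
  is_derive x w (fun y => dot (grad f y) u) (dot (w *m hessian f x) u).
Proof.
move=> dg.
have dcoord j : is_derive x w (fun y => grad f y 0 j) ((w *m hessian f x) 0 j).
  have lim : (fun h : R => (h^-1 *: ((grad f \o shift x) (h *: w) - grad f x)) 0 j)
      @ 0^' --> (w *m hessian f x) 0 j.
    rewrite mul_rV_lin1 -deriveE//.
    have := diff_derivable (v := w) dg.
    rewrite /derivable /derive => dl.
    exact: (cvg_comp _ _ dl (@coord_continuous R 1 d 0 j _)).
  have E : (fun h : R => h^-1 *: (((fun y => grad f y 0 j) \o shift x) (h *: w)
              - grad f x 0 j))
      = (fun h : R => (h^-1 *: ((grad f \o shift x) (h *: w) - grad f x)) 0 j).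
    by apply/funext => h /=; move: (grad f _) (grad f x) => A B; rewrite !mxE.
  apply: DeriveDef; first by rewrite /derivable E; apply/cvg_ex;
    exists ((w *m hessian f x) 0 j).
  by rewrite /derive E; exact: cvg_lim lim.
rewrite /dot (_ : (fun y => _) =
  \sum_(j < d) (u 0 j \*: (fun y => grad f y 0 j))); last first.
  by apply/funext => y; rewrite fct_sumE; apply: eq_bigr => j _; rewrite /= mulrC.
rewrite (_ : \sum_j _ = \sum_(j < d) (u 0 j *: (w *m hessian f x) 0 j)); last first.
  by apply: eq_bigr => j _; rewrite mulrC.
by apply: is_derive_sum => j; apply: is_deriveZ.
Qed.

(** The mean value theorem for [g] minus the quadratic [s * a + s ^+ 2 / 2 * b];
    the Taylor estimates below are instances of it along a segment. *)
Lemma line_taylor (g dg : R -> R) (a b : R) :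
  (forall s : R, is_derive s 1 g (dg s)) ->
  exists2 c, 0 < c < 1 & g 1 - g 0 - a - b / 2 = dg c - a - c * b.
Proof.
move=> dgP.
pose q s : R := g s - a * s - b / 2 * s ^+ 2.
have dq (s : R) : is_derive s 1 q (dg s - a - s * b).
  by apply: is_derive_eq; rewrite /GRing.scale/= !mulr1; field.
have cq : {within `[0, 1], continuous q}.
  by apply: derivable_within_continuous => s _; have [] := dq s.
have [c c01 E] := MVT ltr01 (fun s _ => dq s) cq.
exists c; first by move: c01; rewrite in_itv.
by move: E; rewrite subr0 mulr1 => <-; rewrite /q expr1n expr0n/=; ring.
Qed.

End LineDerivatives.

Section TaylorEstimates.
Context {R : realType} {d : nat}.
Implicit Types (u v w x y : 'rV[R]_d) (f : 'rV[R]_d -> R).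

Lemma dot_mulmxB u v (A B : 'M[R]_d) :
  dot (u *m (A - B)) v = dot (u *m A) v - dot (u *m B) v.
Proof. by rewrite mulmxBr !dotE. Qed.

Lemma dot_mulmxDl u v w (A : 'M[R]_d) :
  dot ((u + v) *m A) w = dot (u *m A) w + dot (v *m A) w.
Proof. by rewrite mulmxDl !dotE. Qed.

Lemma le0_of_le_linear (a K : R) : (forall t, 0 < t -> a <= K * t) -> a <= 0.
Proof.
move=> h; rewrite leNgt; apply/negP => a0.
have K1 : 0 < `|K| + 1 by rewrite ltr_wpDl.
have t0 : 0 < a / (2 * (`|K| + 1)) by rewrite divr_gt0// mulr_gt0.
have := h _ t0.
have : K * (a / (2 * (`|K| + 1))) <= (`|K| + 1) * (a / (2 * (`|K| + 1))).
  by rewrite ler_pM2r// (le_trans (ler_norm _))// lerDl.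
have -> : (`|K| + 1) * (a / (2 * (`|K| + 1))) = a / 2.
  by field; rewrite gt_eqF.
lra.
Qed.

Lemma descent_lemma f (L : R) x y : (forall z, differentiable f z) ->
  smooth L f ->
  f y <= f x + dot (grad f x) (y - x) + L / 2 * enorm (y - x) ^+ 2.
Proof.
move=> df fL; set w := y - x; have xw : x + w = y by rewrite addrC /w subrK.
have dline (s : R) : is_derive s 1 (fun r : R => f (x + r *: w))
    (dot (grad f (x + s *: w)) w).
  exact/is_derive_line/is_derive_grad.
have [c /andP[c0 c1]] := line_taylor (dot (grad f x) w) (L * enorm w ^+ 2) dline.
rewrite scale1r scale0r addr0 xw => E.
suff : dot (grad f (x + c *: w) - grad f x) w <= c * (L * enorm w ^+ 2)
  by rewrite dotDl dotNl; lra.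
rewrite (le_trans (cauchy_schwarz _ _))// expr2 !mulrA ler_wpM2r ?enorm_ge0//.
rewrite (le_trans (fL _ _))// addrC addKr enormZ gtr0_norm//; lra.
Qed.

(** The constant [LH] instead of [LH / 2] is what the mean value theorem gives
    directly; the contraction estimate tolerates it. *)
Lemma grad_taylor f (LH : R) x y : 0 <= LH ->
  (forall z, differentiable (grad f) z) -> hessian_lipschitz LH f ->
  enorm (grad f y - grad f x - (y - x) *m hessian f x)
    <= LH * enorm (y - x) ^+ 2.
Proof.
move=> LH0 dg fLH; set w := y - x; have xw : x + w = y by rewrite addrC /w subrK.
apply: enorm_le_of_dot => [|u]; first by rewrite mulr_ge0// sqr_ge0.
have dline (s : R) : is_derive s 1 (fun r : R => dot (grad f (x + r *: w)) u)
    (dot (w *m hessian f (x + s *: w)) u).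
  exact/(@is_derive_line _ _ (fun z => dot (grad f z) u))/is_derive_hessian.
have [c /andP[c0 c1]] := line_taylor (dot (w *m hessian f x) u) 0 dline.
rewrite scale1r scale0r addr0 xw mul0r mulr0 !subr0.
rewrite -!dotNl -!dotDl -mulmxBr => ->.
rewrite (le_trans (cauchy_schwarz _ _))// ler_wpM2r ?enorm_ge0//.
rewrite (le_trans (enorm_mulmx_le _ _))// expr2 mulrA ler_wpM2r ?enorm_ge0//.
rewrite (le_trans (fLH _ _))// addrC addKr enormZ gtr0_norm//.
by rewrite ler_wpM2l// ler_piMl ?enorm_ge0// ltW.
Qed.

Lemma function_taylor f (LH : R) x w : 0 <= LH ->
  twice_differentiable f -> hessian_lipschitz LH f ->
  `|f (x + w) - f x - dot (grad f x) w - dot (w *m hessian f x) w / 2|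
    <= LH * enorm w ^+ 3.
Proof.
move=> LH0 [df dg] fLH.
have dline (s : R) : is_derive s 1 (fun r : R => f (x + r *: w))
    (dot (grad f (x + s *: w)) w).
  exact/is_derive_line/is_derive_grad.
have [c /andP[c0 c1]] :=
  line_taylor (dot (grad f x) w) (dot (w *m hessian f x) w) dline.
rewrite scale1r scale0r addr0 => ->.
rewrite -dotZl -!dotNl -!dotDl scalemxAl.
have := @grad_taylor f LH x (x + c *: w) LH0 dg fLH.
rewrite (_ : x + c *: w - x = c *: w); last by rewrite addrC addKr.
move=> h; rewrite (le_trans (norm_dot_le _ _))// exprSr mulrA.
rewrite ler_wpM2r ?enorm_ge0// (le_trans h)// ler_wpM2l//.
rewrite enormZ gtr0_norm// exprMn ler_piMl ?sqr_ge0// expr_le1// ltW//.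
Qed.

(** The Hessian is the limit of difference quotients of the gradient, hence
    inherits its Lipschitz constant. *)
Lemma hessian_bounded f (L LH : R) x w : 0 <= LH ->
  (forall z, differentiable (grad f) z) -> smooth L f -> hessian_lipschitz LH f ->
  enorm (w *m hessian f x) <= L * enorm w.
Proof.
move=> LH0 dg fL fLH; rewrite -subr_le0.
apply: (@le0_of_le_linear _ (LH * enorm w ^+ 2)) => t t0.
have := grad_taylor x (x + t *: w) LH0 dg fLH.
have := fL (x + t *: w) x.
rewrite (_ : x + t *: w - x = t *: w); last by rewrite addrC addKr.
set g := _ - grad f x => h1 h2.
have : enorm (t *: w *m hessian f x) <= L * enorm (t *: w) + LH * enorm (t *: w) ^+ 2.
  rewrite (le_trans _ (lerD h1 h2))//.
  rewrite -[X in enorm X <= _](subKr g) (le_trans (ler_enormB _ _))//.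
rewrite -scalemxAl !enormZ gtr0_norm// => h; rewrite -(ler_pM2l t0); lra.
Qed.

(** Here [a], [b], [c] stand for the values of a function at [x + w + z],
    [x + w], [x], with gradient and Hessian [g], [H] at [x] and [g'], [H'] at
    [x + w]. The second-order expansion of [a - b] at [x] contains the symmetric
    part of [H]; that at [x + w], where [g'] is [g + w *m H] to first order,
    contains the product [dot (w *m H) z] alone. *)
Let edge_expansion_gap w z (g g' : 'rV[R]_d) (H H' : 'M[R]_d) (a b c : R) :
  dot (w *m H) z - dot (z *m H) w =
  2 * ((a - c - dot g (w + z) - dot ((w + z) *m H) (w + z) / 2)
       - (b - c - dot g w - dot (w *m H) w / 2)
       - (a - b - dot g' z - dot (z *m H') z / 2)
       - dot (g' - g - w *m H) z)
  - dot (z *m (H' - H)) z.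
Proof.
rewrite dot_mulmxB dot_mulmxDl !dotE.
repeat match goal with |- context [dot ?a ?b] => generalize (dot a b) => ? end.
by field.
Qed.

(** The increment of [f] over the edge from [x + w] to [x + w + z], computed
    by expanding [f] at [x] or at [x + w], gives the two products up to terms of
    order three. *)
Lemma hessian_asymmetry_le f (LH : R) x w z : 0 <= LH ->
  twice_differentiable f -> hessian_lipschitz LH f ->
  dot (w *m hessian f x) z - dot (z *m hessian f x) w
    <= 2 * LH * (enorm (w + z) ^+ 3 + enorm w ^+ 3 + enorm z ^+ 3
         + enorm w ^+ 2 * enorm z + enorm w * enorm z ^+ 2).
Proof.
move=> LH0 f2 fLH; have dg := f2.2.
set H := hessian f x; set H' := hessian f (x + w).
have := function_taylor x (w + z) LH0 f2 fLH; set r1 := (X in `|X|).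
have := function_taylor x w LH0 f2 fLH; set r2 := (X in `|X|).
have := function_taylor (x + w) z LH0 f2 fLH; set r3 := (X in `|X|).
have := le_trans (norm_dot_le _ z)
  (ler_wpM2r (enorm_ge0 z) (grad_taylor x (x + w) LH0 dg fLH)).
set r4 := (X in `|X|); rewrite (_ : x + w - x = w); last by rewrite addrC addKr.
have : `|dot (z *m (H' - H)) z| <= LH * enorm w * enorm z * enorm z.
  rewrite (le_trans (norm_dot_le _ _))// ler_wpM2r ?enorm_ge0//.
  rewrite (le_trans (enorm_mulmx_le _ _))// ler_wpM2r ?enorm_ge0//.
  by rewrite (le_trans (fLH _ _))// addrC addKr.
set r5 := (X in `|X|).
have -> : dot (w *m H) z - dot (z *m H) w = 2 * (r1 - r2 - r3 - r4) - r5.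
  rewrite /r1 /r2 /r3 /r4 /r5 (_ : x + w - x = w); last by rewrite addrC addKr.
  by rewrite addrA; exact: edge_expansion_gap.
have le2 (a b : R) : `|a| <= b -> - b <= a <= b by rewrite ler_norml.
move=> /le2/andP[B5 B5'] /le2/andP[B4 B4'] /le2/andP[B3 B3'].
move=> /le2/andP[B2 B2'] /le2/andP[B1 B1'].
move: (enorm (w + z)) (enorm w) (enorm z) r1 r2 r3 r4 r5
  B1 B1' B2 B2' B3 B3' B4 B4' B5 B5'.
move=> nwz nw nz r1 r2 r3 r4 r5 B1 B1' B2 B2' B3 B3' B4 B4' B5 B5'.
have : 0 <= LH * nw * nz * nz by lra.
lra.
Qed.

(** Applied to [t *: u] and [t *: v], the previous bound is quadratic in [t] on
    the left and cubic on the right. *)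
Lemma hessian_symmetric f (LH : R) x u v : 0 <= LH ->
  twice_differentiable f -> hessian_lipschitz LH f ->
  dot (u *m hessian f x) v = dot (v *m hessian f x) u.
Proof.
move=> LH0 f2 fLH.
suff key (w z : 'rV[R]_d) : dot (w *m hessian f x) z - dot (z *m hessian f x) w <= 0.
  by apply/eqP; rewrite eq_le -subr_le0 key -subr_le0 key.
pose K : R := 2 * LH * (enorm (w + z) ^+ 3 + enorm w ^+ 3 + enorm z ^+ 3
  + enorm w ^+ 2 * enorm z + enorm w * enorm z ^+ 2).
apply: (@le0_of_le_linear _ K) => t t0.
have := hessian_asymmetry_le x (t *: w) (t *: z) LH0 f2 fLH.
rewrite -scalerDr !enormZ gtr0_norm// -!scalemxAl !dotZl !dotZr -!mulrA => h.
rewrite -(@ler_pM2l _ (t ^+ 2)) ?exprn_gt0//.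
rewrite (_ : t ^+ 2 * _ = t * (t * dot (w *m hessian f x) z) -
  t * (t * dot (z *m hessian f x) w)); last by ring.
by rewrite (le_trans h)// le_eqVlt; apply/orP; left; apply/eqP; rewrite /K; ring.
Qed.

(** The derivative of a monotone map is positive semidefinite; the
    quantitative expansion stands in for differentiability of [g]. *)
Lemma first_order_psd (LH : R) (g : 'rV[R]_d -> 'rV[R]_d) (H : 'M[R]_d) x w :
  (forall y, 0 <= dot (g y - g x) (y - x)) ->
  (forall y, enorm (g y - g x - (y - x) *m H) <= LH * enorm (y - x) ^+ 2) ->
  0 <= dot (w *m H) w.
Proof.
move=> mono tay; rewrite -oppr_le0.
apply: (@le0_of_le_linear _ (LH * enorm w ^+ 3)) => t t0.
have := mono (x + t *: w); have := tay (x + t *: w).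
rewrite (_ : x + t *: w - x = t *: w); last by rewrite addrC addKr.
set r := g _ - _ => h1 h2.
have := le_trans (norm_dot_le _ (t *: w)) (ler_wpM2r (enorm_ge0 (t *: w)) h1).
rewrite dotDl dotNl -scalemxAl enormZ (gtr0_norm t0) ler_norml => /andP[_].
rewrite [dot (t *: (w *m H)) _]dotZl [dot (w *m H) (t *: w)]dotZr => h3.
rewrite -(@ler_pM2l _ (t ^+ 2)) ?exprn_gt0//.
lra.
Qed.

End TaylorEstimates.

(** * The average objective and its minimizer *)

Section AverageObjective.
Context {R : realType} {d n : nat}.
Variables (L LH : R) (f : 'I_n -> 'rV[R]_d -> R).
Hypothesis n_gt0 : (0 < n)%N.
Hypothesis LH_ge0 : 0 <= LH.
Hypothesis f_diff : forall i, twice_differentiable (f i).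
Hypothesis f_smooth : forall i, smooth L (f i).
Hypothesis f_hlip : forall i, hessian_lipschitz LH (f i).
Implicit Types (u v w x y : 'rV[R]_d).

Definition average_hessian x : 'M[R]_d := n%:R^-1 *: \sum_i hessian (f i) x.

Let averageE : average f = n%:R^-1 \*: \sum_(i < n) f i.
Proof. by apply/funext => x; rewrite /average /= fct_sumE. Qed.

Lemma enorm_average_le (F : 'I_n -> 'rV[R]_d) (c : R) :
  (forall i, enorm (F i) <= c) -> enorm (n%:R^-1 *: \sum_i F i) <= c.
Proof.
move=> Fc; rewrite enormZ ger0_norm ?invr_ge0// ler_pdivrMl ?ltr0n//.
rewrite (le_trans (ler_enorm_sum _ _ _))// (le_trans (ler_sum _ (fun i _ => Fc i)))//.
by rewrite sumr_const card_ord mulr_natl.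
Qed.

Lemma differentiable_average x : differentiable (average f) x.
Proof.
rewrite averageE; apply: differentiableZ; apply: differentiable_sum => i.
by have [] := f_diff i.
Qed.

Lemma grad_average x : grad (average f) x = n%:R^-1 *: \sum_i grad (f i) x.
Proof.
have df i v : derivable (f i) x v by apply: diff_derivable; have [] := f_diff i.
apply/rowP => j; rewrite !mxE summxE averageE.
rewrite deriveZ; last by apply: derivable_sum.
rewrite derive_sum//; congr (_ * _); apply: eq_bigr => i _.
by rewrite mxE.
Qed.

Lemma smooth_average : smooth L (average f).
Proof.
move=> x y; rewrite !grad_average -scalerBr -sumrB.
by apply: enorm_average_le => i; exact: f_smooth.
Qed.

Lemma grad_average_taylor x y :
  enorm (grad (average f) y - grad (average f) x - (y - x) *m average_hessian x)
    <= LH * enorm (y - x) ^+ 2.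
Proof.
rewrite !grad_average -scalemxAr mulmx_sumr -!scalerBr -!sumrB.
apply: enorm_average_le => i.
by apply: grad_taylor => // z; have [] := f_diff i.
Qed.

Lemma average_hessian_symmetric x u v :
  dot (u *m average_hessian x) v = dot (v *m average_hessian x) u.
Proof.
rewrite /average_hessian -!scalemxAr !dotZl !mulmx_sumr; congr (_ * _).
have dot_suml (F : 'I_n -> 'rV[R]_d) w : dot (\sum_i F i) w = \sum_i dot (F i) w.
  rewrite [RHS]exchange_big; apply: eq_bigr => j _.
  by rewrite summxE mulr_suml.
rewrite !dot_suml; apply: eq_bigr => i _.
exact: (hessian_symmetric _ _ _ LH_ge0).
Qed.

End AverageObjective.

Section StrongConvexity.
Context {R : realType} {d : nat}.
Variables (mu L : R) (F : 'rV[R]_d -> R) (xstar : 'rV[R]_d).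
Hypothesis F_diff : forall x, differentiable F x.
Hypothesis F_smooth : smooth L F.
Hypothesis F_convex : strongly_convex mu F.
Hypothesis F_min : unique_minimizer F xstar.

(** A small gradient step from a minimizer would otherwise decrease [F]. *)
Lemma grad_minimizer : grad F xstar = 0.
Proof.
apply: enorm0_eq0; apply/eqP; rewrite -sqrf_eq0 eq_le sqr_ge0 andbT.
set g := grad F xstar.
apply: (@le0_of_le_linear _ _ (L / 2 * enorm g ^+ 2)) => t t0.
have := descent_lemma xstar (xstar - t *: g) F_diff F_smooth.
rewrite (_ : xstar - t *: g - xstar = - (t *: g)); last by rewrite addrC addKr.
rewrite enormN enormZ (gtr0_norm t0) dotNr dotZr -/g -sqr_enorm => h.
have {}h := le_trans (F_min.1 _) h.
rewrite -(ler_pM2l t0); lra.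
Qed.

Lemma strong_monotonicity x y :
  mu * enorm (x - y) ^+ 2 <= dot (grad F x - grad F y) (x - y).
Proof.
have := F_convex x y; have := F_convex y x.
rewrite -(opprB x y) enormN dotNr dotDl dotNl.
lra.
Qed.

(** Compare [F x] with the minimum in two ways: by a gradient step from [x], and
    by the tangent plane at [x] evaluated at a step [L^-1 *: grad F x] away from
    [xstar]. Each gains [enorm (grad F x) ^+ 2 / (2 * L)]; one alone would lose
    a factor two, and with it the contraction when [h * L] is close to [2 / 3]. *)
Lemma grad_cocoercive x : 0 <= mu -> 0 < L ->
  enorm (grad F x) ^+ 2 <= L * dot (x - xstar) (grad F x).
Proof.
move=> mu0 L0; set g := grad F x.
have h1 := descent_lemma x (x - L^-1 *: g) F_diff F_smooth.
have h2 := descent_lemma xstar (xstar + L^-1 *: g) F_diff F_smooth.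
have h3 := F_convex (xstar + L^-1 *: g) x.
have h4 := F_min.1 (x - L^-1 *: g).
move: h1 h2 h3; rewrite grad_minimizer dot0l -/g.
rewrite (_ : x - _ - x = - (L^-1 *: g)); last by rewrite addrC addKr.
rewrite (_ : xstar + _ - xstar = L^-1 *: g); last by rewrite addrC addKr.
rewrite (_ : xstar + _ - x = - (x - xstar) + L^-1 *: g); last by rewrite addrAC opprB.
move: (x - xstar) => e.
rewrite enormN enormZ gtr0_norm ?invr_gt0// !dotE (dotC g e) -/g -sqr_enorm.
have : 0 <= mu / 2 * enorm (- e + L^-1 *: g) ^+ 2.
  by rewrite mulr_ge0 ?sqr_ge0// divr_ge0.
have -> : L / 2 * (L^-1 * enorm g) ^+ 2 = L^-1 * enorm g ^+ 2 / 2.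
  by field; rewrite gt_eqF.
move=> h0 h1 h2 h3; rewrite -ler_pdivrMl//.
lra.
Qed.

End StrongConvexity.

(** * Contraction for a pair of opposite epochs *)

Section PairContraction.
Context {R : realType} {d : nat}.

(** One epoch, averaged over an order and its reverse, in terms of vectors
    only. Here [e] is the error at the start, [p] the full gradient, [H] the
    averaged Hessian and [h] the step size times the number of components; [b]
    and [b'] are the deviations of the two epochs from a gradient step of length
    [h]. Only their sum enters to first order, and its leading part
    [h ^+ 2 *: (p *m H)] is as harmless as [h ^+ 2 * enorm p ^+ 2], because
    [e *m H] is close to [p]. *)
Lemma pair_contraction (mu L LH h B : R) (e p b b' w : 'rV[R]_d) (H : 'M[R]_d) :
  0 < mu -> 0 < h -> 0 <= LH -> 0 <= L -> h * L <= 2 / 3 ->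
  h * (LH * L * enorm e) <= mu / 4 ->
  mu * enorm e ^+ 2 <= dot e p ->
  enorm p ^+ 2 <= L * dot e p -> enorm p <= L * enorm e ->
  enorm (e *m H - p) <= LH * enorm e ^+ 2 ->
  dot (p *m H) e = dot (e *m H) p -> 0 <= dot (p *m H) p ->
  b + b' = h ^+ 2 *: (p *m H) + w ->
  enorm b <= B -> enorm b' <= B ->
  enorm (e - h *: p + b) ^+ 2 + enorm (e - h *: p + b') ^+ 2
    <= 2 * ((1 - h * mu / 4) * enorm e ^+ 2
            + (3 * enorm w ^+ 2 / (2 * (h * mu)) + B ^+ 2)).
Proof.
move=> mu0 h0 LH0 L0 hL hD mono coco pL tay sym psd bb bB b'B.
set a := e - h *: p.
have -> : enorm (a + b) ^+ 2 + enorm (a + b') ^+ 2 =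
    2 * enorm a ^+ 2 + 2 * dot a (b + b') + enorm b ^+ 2 + enorm b' ^+ 2.
  by rewrite !sqr_enormD dotDr; ring.
have sqrB (c : 'rV[R]_d) : enorm c <= B -> enorm c ^+ 2 <= B ^+ 2.
  move=> cB; rewrite lerXn2r// nnegrE ?enorm_ge0//.
  exact: le_trans (enorm_ge0 c) cB.
have b2 := sqrB b bB; have b'2 := sqrB b' b'B.
have aE : enorm a ^+ 2 = enorm e ^+ 2 - 2 * h * dot e p + h ^+ 2 * enorm p ^+ 2.
  by rewrite !sqr_enorm /a !dotE (dotC p e); ring.
have hp : h * enorm p ^+ 2 <= 2 / 3 * dot e p.
  have ep0 : 0 <= dot e p by rewrite (le_trans _ mono)// mulr_ge0 ?sqr_ge0// ltW.
  by rewrite (le_trans (ler_wpM2l (ltW h0) coco))// mulrA ler_wpM2r.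
have hp2 : h ^+ 2 * enorm p ^+ 2 <= 2 / 3 * (h * dot e p).
  have E : h * (2 / 3 * dot e p) = 2 / 3 * (h * dot e p) by ring.
  by rewrite expr2 -mulrA -E ler_wpM2l// ltW.
have hmono := ler_wpM2l (ltW h0) mono.
have ae : enorm a ^+ 2 <= enorm e ^+ 2.
  have : 0 <= h * (mu * enorm e ^+ 2).
    exact: mulr_ge0 (ltW h0) (mulr_ge0 (ltW mu0) (sqr_ge0 _)).
  by rewrite aE -mulrA; lra.
have hmu : 0 < h * mu by rewrite mulr_gt0.
(* Cocoercivity leaves a decrease of [4 / 3 * h * mu]; the Hessian error uses
   [1 / 2] of [h * mu] and Young's inequality [1 / 3], so [1 / 2] remains. *)
have young : 2 * dot a w <= h * mu / 3 * enorm e ^+ 2 + 3 * enorm w ^+ 2 / (h * mu).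
  have ae' : enorm a <= enorm e by rewrite -ler_sqr ?nnegrE ?enorm_ge0.
  have dw : dot a w <= enorm e * enorm w.
    by rewrite (le_trans (cauchy_schwarz _ _))// ler_wpM2r ?enorm_ge0.
  have : 0 <= (h * mu / 3) * (enorm e - 3 * enorm w / (h * mu)) ^+ 2.
    by rewrite mulr_ge0 ?sqr_ge0// divr_ge0// ltW.
  have -> : h * mu / 3 * (enorm e - 3 * enorm w / (h * mu)) ^+ 2 =
     h * mu / 3 * enorm e ^+ 2 - 2 * (enorm e * enorm w) + 3 * enorm w ^+ 2 / (h * mu).
    by field; rewrite !gt_eqF.
  lra.
have eH : h ^+ 2 * dot e (p *m H) <= h ^+ 2 * enorm p ^+ 2 + h * mu / 4 * enorm e ^+ 2.
  have ep : dot (e *m H - p) p <= LH * enorm e ^+ 2 * (L * enorm e).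
    rewrite (le_trans (cauchy_schwarz _ _))//.
    by rewrite ler_pM ?enorm_ge0.
  have : h * (h * dot (e *m H - p) p) <= h * (mu / 4 * enorm e ^+ 2).
    rewrite ler_pM2l// (le_trans (ler_wpM2l (ltW h0) ep))//.
    rewrite (_ : h * _ = h * (LH * L * enorm e) * enorm e ^+ 2); last by ring.
    by rewrite ler_wpM2r ?sqr_ge0.
  rewrite (dotC e) sym dotDl dotNl -sqr_enorm; lra.
have psd' : 0 <= h ^+ 3 * dot p (p *m H) by rewrite dotC mulr_ge0// exprn_ge0// ltW.
have aw : dot a (b + b') = h ^+ 2 * dot e (p *m H) - h ^+ 3 * dot p (p *m H) + dot a w.
  by rewrite bb /a !dotE; ring.
rewrite aw aE.
have -> : 3 * enorm w ^+ 2 / (2 * (h * mu)) = 3 * enorm w ^+ 2 / (h * mu) / 2.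
  by field; rewrite !gt_eqF.
lra.
Qed.

End PairContraction.

(** * Reversing a permutation *)

Section Reversal.
Context {n : nat}.

Definition reversed (s : 'S_n) : 'S_n := (perm (@rev_ord_inj n) * s)%g.

Lemma reversedE s j : reversed s j = s (rev_ord j).
Proof. by rewrite permM permE. Qed.

Lemma reversedK : involutive reversed.
Proof. by move=> s; apply/permP => j; rewrite !reversedE rev_ordK. Qed.

(** The ordered pairs [(j, k)] with [j < k] in one order are those with
    [k < j] in the reversed order; together they exhaust the pairs of distinct
    indices, so that the permutation drops out. *)
Lemma sum_pairs_reversed (V : zmodType) (M : 'I_n -> 'I_n -> V) (s : 'S_n) :
  \sum_(k < n) \sum_(j < n | (j < k)%N) M (s j) (s k)
  + \sum_(k < n) \sum_(j < n | (j < k)%N) M (reversed s j) (reversed s k)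
  = \sum_(k < n) \sum_(j < n) M j k - \sum_(k < n) M k k.
Proof.
move: (reversed s) (reversedE s) => s' s'E.
have -> : \sum_(k < n) \sum_(j < n | (j < k)%N) M (s' j) (s' k)
    = \sum_(k < n) \sum_(j < n | (k < j)%N) M (s j) (s k).
  rewrite [LHS](reindex_inj (@rev_ord_inj n)) /=; apply: eq_bigr => k _.
  rewrite [LHS](reindex_inj (@rev_ord_inj n)) /=; apply: eq_big => [j|j _].
    by rewrite ltn_sub2lE// ltnS.
  by rewrite !s'E !rev_ordK.
have -> : \sum_(k < n) \sum_(j < n) M j k = \sum_(k < n) \sum_(j < n) M (s j) (s k).
  rewrite [LHS](reindex_inj (@perm_inj _ s)); apply: eq_bigr => k _.
  by rewrite [LHS](reindex_inj (@perm_inj _ s)).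
rewrite [X in _ = _ - X](reindex_inj (@perm_inj _ s)) -sumrB -big_split /=.
apply: eq_bigr => k _; rewrite [X in _ = X - _](bigD1 k)//= addrAC subrr add0r.
rewrite [RHS](bigID (fun j : 'I_n => (j < k)%N)) /=; congr (_ + _).
  by apply: eq_bigl => j; rewrite -val_eqE ltn_neqAle; case: eqP.
by apply: eq_bigl => j; rewrite -val_eqE -leqNgt ltn_neqAle eq_sym.
Qed.

End Reversal.

Lemma average_product {R : realType} {d n : nat} (gamma : R)
    (g : 'I_n -> 'rV[R]_d) (H : 'I_n -> 'M[R]_d) : (0 < n)%N ->
  (gamma * n%:R) ^+ 2 *: ((n%:R^-1 *: \sum_i g i) *m (n%:R^-1 *: \sum_i H i))
  = gamma ^+ 2 *: \sum_k \sum_j g j *m H k.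
Proof.
move=> n0; rewrite -scalemxAr -scalemxAl !scalerA.
congr (_ *: _); first by field; rewrite pnatr_eq0 -lt0n.
by rewrite mulmx_sumr; apply: eq_bigr => k _; rewrite mulmx_suml.
Qed.

(** * Second-order expansion of one epoch *)

Section OneEpoch.
Context {R : realType} {d n : nat}.
Variables (gamma L LH G : R) (f : 'I_n -> 'rV[R]_d -> R) (x : 'rV[R]_d).
Hypothesis n_gt0 : (0 < n)%N.
Hypothesis gamma_ge0 : 0 <= gamma.
Hypothesis L_ge0 : 0 <= L.
Hypothesis LH_ge0 : 0 <= LH.
Hypothesis G_ge0 : 0 <= G.
Hypothesis f_diff : forall i, twice_differentiable (f i).
Hypothesis f_smooth : forall i, smooth L (f i).
Hypothesis f_hlip : forall i, hessian_lipschitz LH (f i).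

Local Notation it := (epoch_iterate gamma f).
Local Notation g i := (grad (f i) x).
Local Notation H i := (hessian (f i) x).
Local Notation h := (gamma * n%:R).

Lemma epoch_iterate0 s y : it s y 0 = y.
Proof. by rewrite /epoch_iterate take0. Qed.

Lemma epoch_iterateS s y (k : 'I_n) : it s y k.+1 = sgd_step gamma f (it s y k) (s k).
Proof.
have ks : (k < size [seq s j | j <- enum 'I_n])%N by rewrite size_map size_enum_ord.
have nk : nth (s k) [seq s j | j <- enum 'I_n] k = s k.
  by rewrite (nth_map k) ?size_enum_ord// nth_ord_enum.
by rewrite /epoch_iterate (take_nth (s k) ks) -cats1 foldl_cat /= nk.
Qed.

Lemma epoch_iterate_sum s y k : (k <= n)%N ->
  it s y k = y - gamma *: \sum_(j < n | (j < k)%N) grad (f (s j)) (it s y j).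
Proof.
elim: k => [_|k IH kn].
  by rewrite epoch_iterate0 big_pred0 ?scaler0 ?subr0.
rewrite (epoch_iterateS s y (Ordinal kn)) /sgd_step [in LHS]IH 1?ltnW// -addrA.
rewrite -opprD -scalerDr; congr (_ - _ *: _).
rewrite [RHS](bigD1 (Ordinal kn)) ?ltnSn//= addrC; congr (_ + _).
  by apply: eq_bigl => j; rewrite ltnS [RHS]andbC -val_eqE -ltn_neqAle.
by rewrite -IH// ltnW.
Qed.

Lemma enorm_ord_sum_le (P : pred 'I_n) (F : 'I_n -> 'rV[R]_d) (c : R) : 0 <= c ->
  (forall j, enorm (F j) <= c) -> enorm (\sum_(j | P j) F j) <= n%:R * c.
Proof.
move=> c0 Fc; rewrite (le_trans (ler_enorm_sum _ _ _))// mulr_natl.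
rewrite -[X in _ *+ X]card_ord -sumr_const big_mkcond ler_sum// => j _.
by case: ifP.
Qed.

Section Trajectory.
Variable s : 'S_n.
Hypothesis grad_bounded : forall i k, (k <= n)%N -> enorm (grad (f i) (it s x k)) <= G.

Let y k := it s x k.

Lemma displacement_le k : (k <= n)%N -> enorm (y k - x) <= h * G.
Proof.
move=> kn; rewrite /y epoch_iterate_sum// addrC addKr enormN enormZ ger0_norm//.
rewrite -mulrA ler_wpM2l// enorm_ord_sum_le// => j.
by rewrite grad_bounded// ltnW.
Qed.

Lemma grad_drift_le i k : (k <= n)%N -> enorm (grad (f i) (y k) - g i) <= L * (h * G).
Proof.
by move=> kn; rewrite (le_trans (f_smooth _ _ _))// ler_wpM2l// displacement_le.
Qed.

Definition epoch_deviation := it s x n - (x - h *: grad (average f) x).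

Lemma full_gradient_stepE : h *: grad (average f) x = gamma *: \sum_j g (s j).
Proof.
rewrite grad_average// scalerA mulfK ?pnatr_eq0 -?lt0n//; congr (_ *: _).
by rewrite [LHS](reindex_inj (@perm_inj _ s)).
Qed.

Let deviationE :
  epoch_deviation = - (gamma *: \sum_j (grad (f (s j)) (y j) - g (s j))).
Proof.
rewrite /epoch_deviation full_gradient_stepE epoch_iterate_sum//.
rewrite (eq_bigl xpredT) => [|j]; last by rewrite ltn_ord.
by rewrite sumrB scalerBr !opprB [LHS]addrC addrA subrK.
Qed.

Lemma deviation_le : enorm epoch_deviation <= h ^+ 2 * (L * G).
Proof.
rewrite deviationE enormN enormZ ger0_norm//.
rewrite (_ : h ^+ 2 * _ = gamma * (n%:R * (L * (h * G)))); last by ring.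
rewrite ler_wpM2l// enorm_ord_sum_le ?mulr_ge0// => j.
by rewrite grad_drift_le// ltnW.
Qed.

(** The effect on later gradients of the displacement caused by earlier ones,
    with all gradients and Hessians frozen at the start of the epoch. *)
Definition second_order_part : 'rV[R]_d :=
  gamma ^+ 2 *: \sum_(k < n) \sum_(j < n | (j < k)%N) g (s j) *m H (s k).

(** Two errors of order three: the Taylor remainder of each component gradient,
    and the drift of the earlier gradients inside the displacement. *)
Lemma deviation_second_order :
  enorm (epoch_deviation - second_order_part)
    <= h ^+ 3 * (LH * G ^+ 2 + L ^+ 2 * G).
Proof.
have -> : epoch_deviation - second_order_part = - (gamma *: \sum_(k < n)
    ((grad (f (s k)) (y k) - g (s k) - (y k - x) *m H (s k))
     + (y k - x + gamma *: \sum_(j < n | (j < k)%N) g (s j)) *m H (s k))).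
  rewrite deviationE /second_order_part expr2 -scalerA -opprD -scalerDr.
  congr (- (_ *: _)); rewrite scaler_sumr -big_split; apply: eq_bigr => k _ /=.
  by rewrite [X in _ = _ + X]mulmxDl addrA subrK -scalemxAl mulmx_suml.
rewrite enormN enormZ ger0_norm//.
rewrite (_ : h ^+ 3 * _ =
  gamma * (n%:R * (LH * (h * G) ^+ 2 + L * (h * (L * (h * G)))))); last by ring.
rewrite ler_wpM2l// enorm_ord_sum_le// => [|k].
  by rewrite addr_ge0 ?mulr_ge0 ?sqr_ge0.
have kn : (k <= n)%N by rewrite ltnW.
have dg i z : differentiable (grad (f i)) z by have [] := f_diff i.
rewrite (le_trans (ler_enormD _ _))// lerD//.
  rewrite (le_trans (grad_taylor _ _ LH_ge0 (dg _) (f_hlip _)))// ler_wpM2l//.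
  by rewrite lerXn2r ?nnegrE ?enorm_ge0 ?mulr_ge0// displacement_le.
rewrite (le_trans (hessian_bounded _ _ LH_ge0 (dg _) (f_smooth _) (f_hlip _)))//.
rewrite ler_wpM2l// {1}/y epoch_iterate_sum// addrAC addrC addrA addKr.
rewrite addrC -scalerBr -sumrB enormZ ger0_norm// -mulrA ler_wpM2l//.
rewrite enorm_ord_sum_le ?mulr_ge0// => j.
by rewrite enorm_distC grad_drift_le// ltnW.
Qed.

End Trajectory.

(** The sum over all pairs factors into the full gradient times the average
    Hessian; the diagonal is all that remains of the permutation. *)
Lemma second_order_part_reversed s :
  second_order_part s + second_order_part (reversed s)
  = h ^+ 2 *: (grad (average f) x *m average_hessian f x)
    - gamma ^+ 2 *: \sum_i g i *m H i.
Proof.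
rewrite grad_average// /average_hessian average_product//.
rewrite /second_order_part.
have scale_pairs (a : R) (A B C D : 'rV[R]_d) : A + B = C - D ->
    a *: A + a *: B = a *: C - a *: D.
  by move=> E; rewrite -scalerDr E scalerBr.
exact: scale_pairs (sum_pairs_reversed (fun i j => g i *m H j) s).
Qed.

End OneEpoch.

(** * Recursion over the epochs *)

Section Convergence.
Context {R : realType} {d n : nat}.
Variables (gamma mu L LH D G : R) (f : 'I_n -> 'rV[R]_d -> R) (xstar : 'rV[R]_d).
Hypothesis n_gt0 : (0 < n)%N.
Hypothesis gamma_gt0 : 0 < gamma.
Hypothesis mu_gt0 : 0 < mu.
Hypothesis L_gt0 : 0 < L.
Hypothesis LH_ge0 : 0 <= LH.
Hypothesis G_ge0 : 0 <= G.
Hypothesis f_diff : forall i, twice_differentiable (f i).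
Hypothesis f_smooth : forall i, smooth L (f i).
Hypothesis f_hlip : forall i, hessian_lipschitz LH (f i).
Hypothesis F_convex : strongly_convex mu (average f).
Hypothesis F_min : unique_minimizer (average f) xstar.
Hypothesis grad_bounded : forall i x,
  enorm (x - xstar) <= D -> enorm (grad (f i) x) <= G.

Local Notation it := (epoch_iterate gamma f).
Local Notation h := (gamma * n%:R).
Local Notation K := (LH * G ^+ 2 + L ^+ 2 * G).

Hypothesis hL : h * L <= 2 / 3.
Hypothesis hLHL : h * (LH * L * D) <= mu / 4.

Let h_gt0 : 0 < h. Proof. by rewrite mulr_gt0// ltr0n. Qed.

(** The first term comes from the diagonal terms left over by the
    symmetrization and from the third-order remainders, divided by the
    contraction rate through Young's inequality; the second is the square of a
    single deviation. *)
Definition epoch_error : R :=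
  3 * (gamma ^+ 2 * (n%:R * (L * G)) + 2 * (h ^+ 3 * K)) ^+ 2 / (2 * (h * mu))
  + (h ^+ 2 * (L * G)) ^+ 2.

Lemma epoch_pair_contraction (s : 'S_n) x :
  (forall k, (k <= n)%N -> enorm (it s x k - xstar) <= D) ->
  (forall k, (k <= n)%N -> enorm (it (reversed s) x k - xstar) <= D) ->
  enorm (it s x n - xstar) ^+ 2 + enorm (it (reversed s) x n - xstar) ^+ 2
    <= 2 * ((1 - h * mu / 4) * enorm (x - xstar) ^+ 2 + epoch_error).
Proof.
move=> sD rsD.
have gs i k : (k <= n)%N -> enorm (grad (f i) (it s x k)) <= G.
  by move=> kn; rewrite grad_bounded ?sD.
have grs i k : (k <= n)%N -> enorm (grad (f i) (it (reversed s) x k)) <= G.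
  by move=> kn; rewrite grad_bounded ?rsD.
have xD : enorm (x - xstar) <= D by rewrite -(epoch_iterate0 gamma f s x) sD.
have gamma0 := ltW gamma_gt0; have L0 := ltW L_gt0; have h0 := ltW h_gt0.
set e := x - xstar; set p := grad (average f) x; set H := average_hessian f x.
set b := epoch_deviation gamma f x s.
set b' := epoch_deviation gamma f x (reversed s).
pose m := gamma ^+ 2 *: \sum_i grad (f i) x *m hessian (f i) x.
pose w := (b - second_order_part gamma f x s)
  + (b' - second_order_part gamma f x (reversed s)) - m.
have F_diff := differentiable_average f_diff.
have F_smooth := smooth_average n_gt0 f_diff f_smooth.
have F_grad0 := grad_minimizer F_diff F_smooth F_min.
have F_taylor := grad_average_taylor n_gt0 LH_ge0 f_diff f_hlip.
have F_mono := strong_monotonicity F_convex.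
have split s' : it s' x n - xstar = e - h *: p + epoch_deviation gamma f x s'.
  rewrite /epoch_deviation -/p /e; move: (it s' x n) (h *: p) => y v.
  by apply/rowP => j; rewrite !mxE; ring.
have bb : b + b' = h ^+ 2 *: (p *m H) + w.
  have := second_order_part_reversed gamma x n_gt0 f_diff s.
  rewrite -/p -/H -/m => /eqP; rewrite eq_sym subr_eq => /eqP ->.
  suff cancel (c c' A B M : 'rV[R]_d) : c + c' = A + B + M + (c - A + (c' - B) - M).
    exact: cancel.
  by apply/rowP => j; rewrite !mxE; ring.
have wle : enorm w <= gamma ^+ 2 * (n%:R * (L * G)) + 2 * (h ^+ 3 * K).
  rewrite /w (le_trans (ler_enormB _ _))// addrC lerD//.
    rewrite enormZ ger0_norm ?sqr_ge0// ler_wpM2l ?sqr_ge0//.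
    rewrite enorm_ord_sum_le ?mulr_ge0// => i.
    have dgi z : differentiable (grad (f i)) z by have [] := f_diff i.
    rewrite (le_trans (hessian_bounded _ _ LH_ge0 dgi (f_smooth i) (f_hlip i)))//.
    by rewrite ler_wpM2l// grad_bounded.
  rewrite (le_trans (ler_enormD _ _))// mulrDl mul1r lerD//.
    exact: deviation_second_order.
  exact: deviation_second_order.
have := @pair_contraction _ _ mu L LH h (h ^+ 2 * (L * G)) e p b b' w H mu_gt0 h_gt0
  LH_ge0 L0 hL.
rewrite !split -/b -/b' => /(_ _ _ _ _ _ _ _ bb _ _) P.
apply: le_trans (P _ _ _ _ _ _ _ _ _) _.
- rewrite (le_trans _ hLHL)// ler_wpM2l// ler_wpM2l// mulr_ge0//.
- by have := F_mono x xstar; rewrite F_grad0 subr0 dotC.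
- exact: grad_cocoercive F_diff F_smooth F_convex F_min _ (ltW mu_gt0) L_gt0.
- by have := F_smooth x xstar; rewrite F_grad0 subr0.
- have := F_taylor x xstar; rewrite F_grad0 sub0r -(opprB x xstar) mulNmx enormN.
  by rewrite opprK addrC.
- exact: average_hessian_symmetric LH_ge0 f_diff f_hlip _ _ _.
- apply: (@first_order_psd _ _ LH (grad (average f)) _ x _ _ (F_taylor x)) => y.
  by rewrite (le_trans _ (F_mono y x))// mulr_ge0 ?sqr_ge0// ltW.
- exact: deviation_le.
- exact: deviation_le.
rewrite ler_wpM2l// lerD2l lerD2r ler_wpM2r ?invr_ge0 ?mulr_ge0// ?(ltW mu_gt0)//.
rewrite ler_wpM2l// lerXn2r ?nnegrE ?enorm_ge0//.
exact: le_trans (enorm_ge0 w) wle.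
Qed.

Section Epochs.
Context {l : nat}.
Variable x0 : 'rV[R]_d.
Implicit Types sigma : {ffun 'I_l -> 'S_n}.

Hypothesis iterate_bounded : forall sigma (t : 'I_l) k, (k <= n)%N ->
  enorm (iterate gamma f x0 sigma t k - xstar) <= D.

Local Notation start := (epoch_start gamma f x0).

Lemma epoch_startS sigma (t : 'I_l) :
  start sigma t.+1 = it (sigma t) (start sigma t) n.
Proof.
have ts : (t < size [seq sigma u | u <- enum 'I_l])%N by rewrite size_map size_enum_ord.
have nt : nth (sigma t) [seq sigma u | u <- enum 'I_l] t = sigma t.
  by rewrite (nth_map t) ?size_enum_ord// nth_ord_enum.
by rewrite /epoch_start (take_nth (sigma t) ts) -cats1 foldl_cat /= nt.
Qed.

Lemma eq_epoch_start sigma sigma' t : (t <= l)%N ->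
  (forall u : 'I_l, (u < t)%N -> sigma u = sigma' u) -> start sigma t = start sigma' t.
Proof.
elim: t => [|t IH] tl eq_s; first by rewrite /epoch_start !take0.
pose o := Ordinal tl; have E := IH (ltnW tl) (fun u ut => eq_s u (ltnW ut)).
apply: etrans (epoch_startS sigma o) _; apply: etrans _ (esym (epoch_startS sigma' o)).
rewrite (_ : start sigma o = start sigma' o); last exact: E.
by rewrite (eq_s o)//= ltnSn.
Qed.

(** The involution of the probability space that pairs the outcomes: epoch [t]
    is replayed in the opposite order, from the same starting point. *)
Definition reverse_epoch (t : 'I_l) sigma : {ffun 'I_l -> 'S_n} :=
  [ffun u => if u == t then reversed (sigma u) else sigma u].

Lemma reverse_epochK t : involutive (reverse_epoch t).
Proof.
move=> sigma; apply/ffunP => u; rewrite !ffunE.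
by case: eqP; rewrite ?reversedK.
Qed.

Lemma reverse_epoch_start t sigma : start (reverse_epoch t sigma) t = start sigma t.
Proof.
apply: eq_epoch_start => [|u ut]; first exact: ltnW.
by rewrite ffunE; case: eqP ut => // ->; rewrite ltnn.
Qed.

Definition total_error t : R :=
  \sum_(sigma : {ffun 'I_l -> 'S_n}) enorm (start sigma t - xstar) ^+ 2.

(** Twice the left side is a sum over all outcomes of the errors of both members
    of a pair, which makes the bound for a pair applicable term by term. *)
Lemma total_error_step (t : 'I_l) :
  total_error t.+1
    <= (1 - h * mu / 4) * total_error t + #|{: {ffun 'I_l -> 'S_n}}|%:R * epoch_error.
Proof.
rewrite -(@ler_pM2l _ 2)// {1}mulr2n mulrDl !mul1r.
rewrite {2}/total_error (reindex_inj (inv_inj (reverse_epochK t))) -big_split /=.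
under eq_bigr do rewrite !epoch_startS reverse_epoch_start ffunE eqxx.
have -> : #|{: {ffun 'I_l -> 'S_n}}|%:R * epoch_error =
    \sum_(sigma : {ffun 'I_l -> 'S_n}) epoch_error by rewrite sumr_const mulr_natl.
rewrite /total_error mulr_sumr -big_split mulr_sumr /=.
apply: ler_sum => sigma _; apply: epoch_pair_contraction => k kn.
  exact: iterate_bounded.
have := iterate_bounded (reverse_epoch t sigma) t kn.
by rewrite /iterate reverse_epoch_start ffunE eqxx.
Qed.

Hypothesis hmu : h * mu <= 1.

Lemma total_error_le t : (0 < l)%N -> (t <= l)%N ->
  total_error t <= #|{: {ffun 'I_l -> 'S_n}}|%:R *
    ((1 - h * mu / 4) ^+ t * D ^+ 2 + epoch_error / (h * mu / 4)).
Proof.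
move=> l_gt0; have hmu_gt0 : 0 < h * mu by rewrite mulr_gt0.
have rate_ge0 : 0 <= 1 - h * mu / 4 by move: hmu; lra.
have err_ge0 : 0 <= epoch_error.
  apply: addr_ge0 (sqr_ge0 _); apply: divr_ge0.
    exact: mulr_ge0 (ler0n _ 3) (sqr_ge0 _).
  exact: mulr_ge0 (ler0n _ 2) (ltW hmu_gt0).
elim: t => [_|t IH tl].
  rewrite expr0 mul1r mulr_natl -sumr_const ler_sum// => sigma _.
  have := iterate_bounded sigma (Ordinal l_gt0) (leq0n n).
  rewrite /iterate epoch_iterate0 /= => sD.
  rewrite (@le_trans _ _ (D ^+ 2))//.
    by rewrite lerXn2r ?nnegrE ?enorm_ge0// (le_trans _ sD) ?enorm_ge0.
  by rewrite lerDl divr_ge0// divr_ge0// ltW.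
rewrite (le_trans (total_error_step (Ordinal tl)))//=.
rewrite (le_trans (lerD (ler_wpM2l rate_ge0 (IH (ltnW tl))) (lexx _)))//.
rewrite le_eqVlt; apply/orP; left; apply/eqP; rewrite (exprS _ t); field.
by rewrite !gt_eqF// ltr0n.
Qed.

Lemma expected_error_le : (0 < l)%N ->
  shuffle_expectation
    (fun sigma : {ffun 'I_l -> 'S_n} => enorm (output gamma f x0 sigma - xstar) ^+ 2)
  <= expR (- (h * mu * l%:R / 4)) * D ^+ 2 + epoch_error / (h * mu / 4).
Proof.
move=> l_gt0; have := total_error_le l_gt0 (leqnn l).
rewrite /shuffle_expectation => le_tot.
rewrite ler_pdivrMr; last by rewrite ltr0n; apply/card_gt0P; exists [ffun=> 1%g].
rewrite mulrC (le_trans le_tot)// ler_wpM2l// lerD2r ler_wpM2r ?sqr_ge0//.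
rewrite (_ : - (h * mu * l%:R / 4) = l%:R * (- (h * mu / 4))); last by ring.
rewrite expRM_natl lerXn2r ?nnegrE ?expR_ge0//; first by move: hmu; lra.
exact: expR_ge1Dx.
Qed.

End Epochs.

(** The geometric series of the per-epoch errors has order
    [gamma ^+ 2 + h ^+ 3]; the bound [h <= mu^-1] turns [h ^+ 4] into
    [h ^+ 3]. *)
Lemma epoch_error_rate_le : h * mu <= 1 ->
  epoch_error / (h * mu / 4)
    <= 12 * (L * G) ^+ 2 / mu ^+ 2 * gamma ^+ 2
       + (48 * K ^+ 2 / mu ^+ 3 + 4 * (L * G) ^+ 2 / mu) * h ^+ 3.
Proof.
move=> hmu; have h_neq0 : h != 0 by rewrite gt_eqF.
have mu_neq0 : mu != 0 by rewrite gt_eqF.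
have -> : epoch_error / (h * mu / 4) =
    6 / mu ^+ 2 * (gamma * (L * G) + 2 * (h ^+ 2 * K)) ^+ 2
    + 4 * (L * G) ^+ 2 / mu * h ^+ 3.
  rewrite /epoch_error.
  rewrite (_ : gamma ^+ 2 * (n%:R * (L * G)) = h * (gamma * (L * G))); last by ring.
  move: h h_neq0 (gamma * (L * G)) => e e0 c.
  by field; rewrite ?e0 ?mu_neq0.
have sq (a b : R) : (a + b) ^+ 2 <= 2 * a ^+ 2 + 2 * b ^+ 2.
  by have := sqr_ge0 (a - b); lra.
have h4 : h ^+ 4 <= h ^+ 3 / mu.
  rewrite ler_pdivlMr// exprSr -mulrA ler_piMr// exprn_ge0// ltW//.
have hsq := ler_wpM2l (_ : 0 <= 6 / mu ^+ 2) (sq (gamma * (L * G)) (2 * (h ^+ 2 * K))).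
have {}hsq := hsq (divr_ge0 (ler0n _ 6) (sqr_ge0 mu)).
have h4K := ler_wpM2l (_ : 0 <= 48 * K ^+ 2 / mu ^+ 2) h4.
have {}h4K := h4K (divr_ge0 (mulr_ge0 (ler0n _ 48) (sqr_ge0 K)) (sqr_ge0 mu)).
rewrite (le_trans (lerD hsq (lexx _)))// [X in _ <= _ + X]mulrDl addrA lerD2r.
rewrite [X in X <= _](_ : _ = 12 * (L * G) ^+ 2 / mu ^+ 2 * gamma ^+ 2
  + 48 * K ^+ 2 / mu ^+ 2 * h ^+ 4); last by field.
rewrite lerD2l (le_trans h4K)// le_eqVlt; apply/orP; left; apply/eqP.
by field.
Qed.

End Convergence.

(** * The convergence rate *)

(** Strong convexity forces [mu <= L], provided that there is a nonzero vector
    to test with. *)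
Lemma smoothness_constants_sign {R : realType} {d n : nat} (mu L LH : R)
    (f : 'I_n -> 'rV[R]_d -> R) : (0 < d)%N -> (0 < n)%N -> 0 < mu ->
  (forall i, twice_differentiable (f i)) -> (forall i, smooth L (f i)) ->
  (forall i, hessian_lipschitz LH (f i)) -> strongly_convex mu (average f) ->
  0 < L /\ 0 <= LH.
Proof.
move=> d_gt0 n_gt0 mu_gt0 f_diff f_smooth f_hlip F_convex.
pose v : 'rV[R]_d := delta_mx 0 (Ordinal d_gt0).
have v_gt0 : 0 < enorm v.
  rewrite lt_neqAle enorm_ge0 andbT; apply/eqP => /esym/enorm0_eq0/rowP.
  move=> /(_ (Ordinal d_gt0)); rewrite !mxE !eqxx => /eqP.
  by rewrite oner_eq0.
split.
  have := strong_monotonicity F_convex v 0.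
  have := smooth_average n_gt0 f_diff f_smooth v 0.
  rewrite !subr0; set g := _ - _ => sm mono.
  have : mu * enorm v ^+ 2 <= L * enorm v * enorm v.
    rewrite (le_trans mono)// (le_trans (cauchy_schwarz _ _))//.
    by rewrite ler_wpM2r ?enorm_ge0.
  rewrite -mulrA -expr2 ler_pM2r ?exprn_gt0//.
  exact: lt_le_trans.
have := f_hlip (Ordinal n_gt0) v 0; rewrite subr0 => hl.
by rewrite -(pmulr_lge0 _ v_gt0) (le_trans (spectral_norm_ge0 _) hl).
Qed.

Theorem theorem2 (R : realType) (mu L LH D G : R)
    (mu_gt0 : 0 < mu) (D_gt0 : 0 < D) (G_gt0 : 0 < G) :
  exists C0 q : R, [/\ 0 < C0, 0 < q &
    forall (d n l T : nat) (f : 'I_n -> 'rV[R]_d -> R) (x0 xstar : 'rV[R]_d),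
      let gamma := 8 * ln T%:R / (T%:R * mu) in
      (forall i, convex_function [set: 'rV[R]_d] (f i)) ->
      (forall i, twice_differentiable (f i)) ->
      (forall i, smooth L (f i)) ->
      (forall i, hessian_lipschitz LH (f i)) ->
      strongly_convex mu (average f) ->
      unique_minimizer (average f) xstar ->
      T = (l * n)%N -> (2 <= T)%N ->
      epoch_constant mu L LH D G * n%:R < T%:R / ln T%:R ->
      (forall (sigma : {ffun 'I_l -> 'S_n}) (t : 'I_l) (k : nat), (k <= n)%N ->
        enorm (iterate gamma f x0 sigma t k - xstar) <= D) ->
      (forall i x, enorm (x - xstar) <= D -> enorm (grad (f i) x) <= G) ->
      shuffle_expectation
        (fun sigma : {ffun 'I_l -> 'S_n} =>
          enorm (output gamma f x0 sigma - xstar) ^+ 2)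
      <= C0 * (1 + ln T%:R) `^ q
           * (1 / T%:R ^+ 2 + n%:R ^+ 3 / T%:R ^+ 3)].
Proof.
pose a : R := 12 * (L * G) ^+ 2 / mu ^+ 2.
pose b : R := 48 * (LH * G ^+ 2 + L ^+ 2 * G) ^+ 2 / mu ^+ 3 + 4 * (L * G) ^+ 2 / mu.
have mu_ge0 := ltW mu_gt0.
have a_ge0 : 0 <= a.
  exact: divr_ge0 (mulr_ge0 (ler0n _ 12) (sqr_ge0 _)) (exprn_ge0 2 mu_ge0).
have b_ge0 : 0 <= b.
  apply: addr_ge0.
    exact: divr_ge0 (mulr_ge0 (ler0n _ 48) (sqr_ge0 _)) (exprn_ge0 3 mu_ge0).
  exact: divr_ge0 (mulr_ge0 (ler0n _ 4) (sqr_ge0 _)) mu_ge0.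
have a'_ge0 : 0 <= 64 * a / mu ^+ 2.
  exact: divr_ge0 (mulr_ge0 (ler0n _ 64) a_ge0) (exprn_ge0 2 mu_ge0).
have b'_ge0 : 0 <= 512 * b / mu ^+ 3.
  exact: divr_ge0 (mulr_ge0 (ler0n _ 512) b_ge0) (exprn_ge0 3 mu_ge0).
have D2_gt0 : 0 < D ^+ 2 by rewrite exprn_gt0.
pose C0 : R := D ^+ 2 + 64 * a / mu ^+ 2 + 512 * b / mu ^+ 3.
have C0_gt0 : 0 < C0 by rewrite /C0; lra.
exists C0, 3; split=> //.
move=> d n l T f x0 xstar gamma _ f_diff f_smooth f_hlip F_convex F_min.
move=> TE T_ge2 T_large iter_bounded grad_bounded.
have [l_gt0 n_gt0] : (0 < l)%N /\ (0 < n)%N.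
  by move: T_ge2; rewrite TE; case: (l) (n) => [|l'] [|n']; rewrite ?muln0.
set t : R := T%:R; set ell : R := ln t.
have t_gt1 : 1 < t by rewrite ltr1n.
have t_gt0 : 0 < t by lra.
have ell_gt0 : 0 < ell by rewrite ln_gt0.
have logE : (1 + ell) `^ 3 = (1 + ell) ^+ 3 by rewrite powR_mulrn//; lra.
have bracket_ge0 : 0 <= 1 / t ^+ 2 + n%:R ^+ 3 / t ^+ 3.
  by rewrite addr_ge0// divr_ge0// exprn_ge0// ltW.
(* In dimension zero the constants [L] and [LH] may be negative. *)
have [d0|d_gt0] := posnP d.
  have e0 (v : 'rV[R]_d) : enorm v = 0.
    by rewrite /enorm /dot big1 ?sqrtr0// => j; have := ltn_ord j; rewrite {2}d0.
  rewrite /shuffle_expectation big1 => [|sigma _]; last by rewrite e0 expr0n.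
  by rewrite mul0r mulr_ge0// mulr_ge0 ?powR_ge0// ltW.
have [L_gt0 LH_ge0] :=
  smoothness_constants_sign d_gt0 n_gt0 mu_gt0 f_diff f_smooth f_hlip F_convex.
have gamma_gt0 : 0 < gamma by rewrite divr_gt0 ?mulr_gt0.
pose h : R := gamma * n%:R.
have h_gt0 : 0 < h by rewrite mulr_gt0// ltr0n.
(* Both entries of [epoch_constant] bound [h]: the second keeps [h * (mu + L)]
   below [2 / 3], the first makes the Hessian error negligible. *)
have h_const c : c <= epoch_constant mu L LH D G -> c * (h * mu) <= 8.
  move=> cC; have cn : c * n%:R <= t / ell.
    by rewrite (le_trans _ (ltW T_large))// ler_wpM2r.
  rewrite (_ : c * (h * mu) = 8 * ((c * n%:R) * ell / t)); last first.
    by rewrite /h /gamma -/t -/ell; field; rewrite !gt_eqF.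
  rewrite -[leRHS]mulr1 ler_wpM2l// ler_pdivrMr// mul1r.
  by rewrite -ler_pdivlMr.
have h_sum : h * (mu + L) <= 2 / 3.
  have := h_const (12 * (1 + L / mu)); rewrite /epoch_constant le_max lexx orbT.
  rewrite (_ : 12 * (1 + L / mu) * (h * mu) = 12 * (h * (mu + L))); last first.
    by field; rewrite gt_eqF.
  by move=> /(_ isT); lra.
have hmu_gt0 : 0 < h * mu by rewrite mulr_gt0.
have hL_gt0 : 0 < h * L by rewrite mulr_gt0.
have hL : h * L <= 2 / 3 by move: h_sum; rewrite mulrDr; lra.
have hmu : h * mu <= 1 by move: h_sum; rewrite mulrDr; lra.
have hLHL : h * (LH * L * D) <= mu / 4.
  have := h_const (32 / mu ^+ 2 * (LH * L * D + 3 * LH * G)).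
  rewrite /epoch_constant le_max lexx => /(_ isT).
  rewrite (_ : 32 / _ * _ * _ = 32 * (h * (LH * L * D + 3 * LH * G)) / mu); last first.
    by field; rewrite gt_eqF.
  rewrite ler_pdivrMr// mulrDr.
  have : 0 <= h * (3 * LH * G).
    by rewrite mulr_ge0 ?(ltW h_gt0)// mulr_ge0 ?(ltW G_gt0)// mulr_ge0.
  lra.
rewrite (le_trans (expected_error_le n_gt0 gamma_gt0 mu_gt0 L_gt0 LH_ge0 (ltW G_gt0)
  f_diff f_smooth f_hlip F_convex F_min grad_bounded hL hLHL iter_bounded hmu l_gt0))//.
have rate := @epoch_error_rate_le R n gamma mu L LH G n_gt0 gamma_gt0 mu_gt0 hmu.
rewrite (le_trans (lerD (lexx _) rate))// -/a -/b -/h logE.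
(* The exponent is exactly [- 2 * ell]: the step size is tuned for this. *)
have -> : expR (- (h * mu * l%:R / 4)) = 1 / t ^+ 2.
  have lnE : t = l%:R * n%:R by rewrite /t TE natrM.
  rewrite (_ : - _ = - (2%:R * ell)); last first.
    rewrite /h /gamma -/t -/ell; apply: congr1.
    have -> : 8 * ell / (t * mu) * n%:R * mu * l%:R / 4 = 2 * ell * (l%:R * n%:R) / t.
      by field; rewrite !gt_eqF.
    by rewrite -lnE mulfK ?gt_eqF.
  by rewrite expRN expRM_natl lnK ?posrE// div1r.
have -> : a * gamma ^+ 2 = 64 * a / mu ^+ 2 * (ell ^+ 2 * (1 / t ^+ 2)).
  by rewrite /gamma -/t -/ell; field; rewrite !gt_eqF.
have -> : b * h ^+ 3 = 512 * b / mu ^+ 3 * (ell ^+ 3 * (n%:R ^+ 3 / t ^+ 3)).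
  by rewrite /h /gamma -/t -/ell; field; rewrite !gt_eqF.
set X := 1 / t ^+ 2; set Y := n%:R ^+ 3 / t ^+ 3.
have X_ge0 : 0 <= X by rewrite divr_ge0// exprn_ge0// ltW.
have Y_ge0 : 0 <= Y by rewrite divr_ge0// exprn_ge0// ltW.
set Lg := (1 + ell) ^+ 3.
(* Expanding the cube, every power of the logarithm that occurs is dominated. *)
have [Lg1 Lg2 Lg3] : [/\ 1 <= Lg, ell ^+ 2 <= Lg & ell ^+ 3 <= Lg].
  have e2 : 0 <= ell ^+ 2 by rewrite exprn_ge0// ltW.
  have e3 : 0 <= ell ^+ 3 by rewrite exprn_ge0// ltW.
  by split; rewrite /Lg (_ : (1 + ell) ^+ 3 = 1 + 3 * ell + 3 * ell ^+ 2 + ell ^+ 3);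
    [lra|ring|lra|ring|lra|ring].
have Lg_ge0 : 0 <= Lg by lra.
have term (u v z w : R) : 0 <= u -> 0 <= z -> 0 <= v -> v <= Lg -> z <= w ->
    u * (v * z) <= u * (Lg * w).
  by move=> u0 z0 v0 vL zw; rewrite ler_wpM2l// ler_pM.
have T1 := term (D ^+ 2) 1 X (X + Y) (ltW D2_gt0) X_ge0 ler01 Lg1.
have T2 := term (64 * a / mu ^+ 2) (ell ^+ 2) X (X + Y) a'_ge0 X_ge0
  (exprn_ge0 2 (ltW ell_gt0)) Lg2.
have T3 := term (512 * b / mu ^+ 3) (ell ^+ 3) Y (X + Y) b'_ge0 Y_ge0
  (exprn_ge0 3 (ltW ell_gt0)) Lg3.
have {}T1 : X * D ^+ 2 <= D ^+ 2 * (Lg * (X + Y)).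
  by rewrite mulrC -[X in _ * X <= _]mul1r T1// lerDl.
have {}T2 := T2 (ler_wpDr Y_ge0 (lexx X)).
have {}T3 := T3 (ler_wpDl X_ge0 (lexx Y)).
rewrite (le_trans (lerD T1 (lerD T2 T3)))// le_eqVlt; apply/orP; left.
by apply/eqP; rewrite /C0; ring.
Qed.
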